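(* Let $n\ge1$ and let $t,u,x_1,\dots,x_n$ be indeterminates. For $1\le i\le n$ let $T_i$ be the operator on rational functions sending $x_i$ to $1/x_i$ (all other variables, including $u$, fixed). Then $$(1+T_1)\cdots(1+T_n)\left(\prod_{i=1}^n\frac{1-tx_i^2}{1-x_i^2}\,\frac{1-tu/x_i}{1-u/x_i}\prod_{1\le i<j\le n}\frac{1-tx_ix_j}{1-x_ix_j}\right)=\prod_{i=1}^{n-1}(t^i+1)\left(t^n+\prod_{i=1}^n\frac{1-tux_i}{1-ux_i}\,\frac{1-tu/x_i}{1-u/x_i}\right).$$ *)

(* Defs.v *)
From HB Require Import structures.
From mathcomp Require Import all_boot all_order all_algebra.
From mathcomp Require Import fraction generic_quotient.
From mathcomp Require Import mpoly.

Set Implicit Arguments.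
Unset Strict Implicit.
Unset Printing Implicit Defensive.

Import GRing.Theory.
Local Open Scope ring_scope.
Local Open Scope quotient_scope.

(* The field F(t, u, x_1, ..., x_n).  Of the 2 + n polynomial variables, number
   0 is t, number 1 is u, and number 2 + i is x_(i+1), for i : 'I_n. *)
Notation ratfun F n := {fraction {mpoly F[2 + n]}}.

Section RationalFunctions.

Variables (F : fieldType) (n : nat).

Definition ratvar (k : 'I_(2 + n)) : ratfun F n :=
  FracField.tofrac ('X_k : {mpoly F[2 + n]}).

Definition tvar : ratfun F n := ratvar (lshift n ord0).
Definition uvar : ratfun F n := ratvar (lshift n ord_max).
Definition xvar (i : 'I_n) : ratfun F n := ratvar (rshift 2 i).

Definition ratconst (c : F) : ratfun F n := FracField.tofrac c%:MP.

Definition invx_poly (i : 'I_n) (p : {mpoly F[2 + n]}) : ratfun F n :=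
  mmap ratconst
    (fun k => if k == rshift 2 i then (ratvar k)^-1 else ratvar k) p.

(* Computed on the representative fraction chosen by [repr]; [invxE] below shows
   that the result does not depend on that choice. *)
Definition invx (i : 'I_n) (f : ratfun F n) : ratfun F n :=
  invx_poly i \n_(repr f) / invx_poly i \d_(repr f).

Definition one_plus_T (i : 'I_n) (f : ratfun F n) : ratfun F n := f + invx i f.

(* (1 + T_1) ... (1 + T_n) as a composition of operators, 1 + T_1 outermost. *)
Definition prod_one_plus_T : ratfun F n -> ratfun F n :=
  \big[comp/id]_(i < n) one_plus_T i.

Fact ratconst_is_zmod_morphism : zmod_morphism ratconst.
Proof. by move=> a b; rewrite /ratconst mpolyCB tofracB. Qed.

Fact ratconst_is_monoid_morphism : monoid_morphism ratconst.
Proof.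
by split=> [|a b]; rewrite /ratconst ?mpolyC1 ?tofrac1 // mpolyCM tofracM.
Qed.

HB.instance Definition _ :=
  GRing.isZmodMorphism.Build F (ratfun F n) ratconst ratconst_is_zmod_morphism.
HB.instance Definition _ :=
  GRing.isMonoidMorphism.Build F (ratfun F n) ratconst
    ratconst_is_monoid_morphism.

Lemma ratvar_neq0 k : ratvar k != 0.
Proof.
rewrite /ratvar tofrac_eq0; apply/eqP => /mpolyP /(_ U_(k)%MM) /eqP.
by rewrite mcoeffX eqxx mcoeff0 oner_eq0.
Qed.

Lemma invx_poly_eq0 i p : (invx_poly i p == 0) = (p == 0).
Proof.
have [->|nz_p] := eqVneq p 0; first by rewrite /invx_poly mmap0 eqxx.
apply/negP => /eqP p0; move/negP: nz_p; apply.
set k := rshift 2 i in p0.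
pose d := (\max_(m <- msupp p) (m k : nat))%N.
have led m : m \in msupp p -> (m k <= d)%N.
  by move=> mp; rewrite /d (big_rem m mp) /= leq_maxl.
pose rv (m : 'X_{1..2 + n}) :=
  [multinom if j == k then (d - m j)%N else m j | j < 2 + n]%MM.
have rv_inj : {in msupp p &, injective rv}.
  move=> m1 m2 h1 h2 /mnmP e; apply/mnmP => j; move: (e j); rewrite !mnmE.
  case: eqP => [-> {}e|//].
  by rewrite -(subKn (led _ h1)) e subKn ?led.
pose q : {mpoly F[2 + n]} := \sum_(m <- msupp p) p@_m *: 'X_[rv m].
have q0 : q == 0.
  rewrite -tofrac_eq0 -(mulr0 (ratvar k ^+ d)) -p0; apply/eqP.
  rewrite /q /invx_poly /mmap mulr_sumr rmorph_sum /=.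
  apply: eq_big_seq => m mp.
  rewrite -mul_mpolyC tofracM mulrCA; congr (_ * _).
  rewrite mpolyXE_id rmorph_prod /mmap1.
  rewrite [LHS](bigD1 k) // [in RHS](bigD1 k) //= -/k eqxx mulrA.
  rewrite mnmE eqxx rmorphXn /=; congr (_ * _).
    rewrite exprVn -[X in _ = ratvar k ^+ X / _](subnK (led _ mp)) exprD.
    by rewrite mulfK // expf_neq0 ?ratvar_neq0.
  by apply: eq_bigr => j /negPf jk; rewrite jk mnmE jk rmorphXn.
apply/eqP/mpolyP => m; rewrite mcoeff0.
have [mp|/memN_msupp_eq0 //] := boolP (m \in msupp p).
move/eqP/mpolyP/(_ (rv m)): q0; rewrite mcoeff0 => <-.
rewrite raddf_sum (bigD1_seq m) ?msupp_uniq //= mcoeffZ mcoeffX eqxx mulr1.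
rewrite big_seq_cond big1 ?addr0 // => m' /andP[m'p ne].
rewrite mcoeffZ mcoeffX; case: eqP => [/rv_inj e|]; last by rewrite mulr0.
by rewrite e ?eqxx in ne.
Qed.

Lemma invxE i (p q : {mpoly F[2 + n]}) : q != 0 ->
  invx i (FracField.tofrac p / FracField.tofrac q : ratfun F n)
    = invx_poly i p / invx_poly i q.
Proof.
move=> nz_q; rewrite /invx; set f := FracField.tofrac p / _.
set a := \n_(repr f); set b := \d_(repr f).
have nz_b : b != 0 by apply: denom_ratioP.
have ef : f = FracField.tofrac a / FracField.tofrac b.
  rewrite -[LHS]reprK -[X in \pi X]Ratio_numden -/a -/b.
  apply/esym; rewrite /GRing.inv /GRing.mul /= !piE; apply/eqmodP => /=.
  rewrite FracField.equivfE /FracField.mulf /FracField.invf.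
  by rewrite !numden_Ratio ?mulf_neq0 ?oner_eq0 // mulr1 mul1r mulrC.
have E : a * q = p * b.
  apply/eqP; rewrite -tofrac_eq !tofracM -eqr_div ?tofrac_eq0 //.
  by rewrite -ef.
apply/eqP; rewrite eqr_div ?invx_poly_eq0 // /invx_poly.
by rewrite -!rmorphM E.
Qed.

End RationalFunctions.

(* Main.v *)
Require Import Defs.
From HB Require Import structures.
From mathcomp Require Import all_boot all_order all_algebra.
From mathcomp Require Import fraction generic_quotient mpoly ring zify.

(* Expanding the operators gives a sum over sign choices, i.e. over the subsets B
   of indices whose variable is inverted.  Regard the difference of the two sides
   as a rational function of u, with simple poles at most at the x_k and 1/x_k.
   Its residue at x_k^{+-1} vanishes because of the identity for the n - 1 other
   variables at u = 0, so the difference is a constant.  Its value at u = infinity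
   is t^n times its value at u = 0, hence the constant is zero. *)

Set Implicit Arguments.
Unset Strict Implicit.
Unset Printing Implicit Defensive.

Import GRing.Theory.
Local Open Scope ring_scope.
Local Open Scope quotient_scope.

(** Splits the subsets of [A] by membership of [k]. It serves both to pair the two signs of one
    variable at a pole and to expand a single operator [1 + T_k]. *)
Lemma sum_subset_setD1 (V : nmodType) (I : finType) (A : {set I}) (k : I)
    (f : {set I} -> V) : k \in A ->
  \sum_(B : {set I} | B \subset A) f B
  = \sum_(B : {set I} | B \subset A :\ k) (f B + f (k |: B)).
Proof.
move=> kA; rewrite big_split /= (bigID (fun B : {set I} => k \in B)) /= addrC.
congr (_ + _).
  by apply: eq_bigl => B; rewrite subsetD1.
rewrite (reindex_onto (fun B => k |: B) (fun B => B :\ k)) /=; last first.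
  by move=> B /andP[_ kB]; rewrite setD1K.
apply: eq_bigl => B; rewrite subUset sub1set kA /= setU11 andbT subsetD1.
congr (_ && _); apply/eqP/idP => [<-|kB]; first by rewrite setD11.
by rewrite setU1K.
Qed.

(** * Size and top coefficient of a product of polynomials *)

Section PolynomialProducts.

Variables (K : fieldType) (I : Type).

(** At the largest exponent allowed by the size bounds, only the coefficients of index [d] of the
    factors contribute. These may be zero, so the statement is about a coefficient rather than a
    leading coefficient; it plays the role of a value at infinity. *)
Lemma size_coef_prod_le (d : nat) (p : I -> {poly K}) (r : seq I) :
  (forall i, size (p i) <= d.+1)%N ->
  (size (\prod_(i <- r) p i)%R <= (d * size r).+1)%N /\
  (\prod_(i <- r) p i)`_(d * size r) = \prod_(i <- r) (p i)`_d.
Proof.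
move=> sp; elim: r => [|i r [IHs IHc]].
  by rewrite !big_nil /= muln0 size_poly1 coefC.
rewrite !big_cons /= mulnS; split.
  apply: (leq_trans (size_polyMleq _ _)).
  rewrite -subn1 leq_subLR (leq_trans (leq_add (sp i) IHs)) //.
  by rewrite addSn addnS add1n.
rewrite coefM -IHc.
have dlt : (d < (d + d * size r).+1)%N by rewrite ltnS leq_addr.
rewrite (bigD1 (Ordinal dlt)) //= addKn [X in _ + X]big1 ?addr0 // => j.
rewrite -val_eqE /= => jd; case: (ltngtP (j : nat) d) jd => // jd _.
  by rewrite [X in _ * X]nth_default ?mulr0 // (leq_trans IHs) //; lia.
by rewrite [X in X * _]nth_default ?mul0r // (leq_trans (sp i)).
Qed.

End PolynomialProducts.

(** * The sum over sign choices, summand by summand *)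

Section SignSum.

Variables (K : fieldType) (n : nat) (t : K).
Implicit Types (A B : {set 'I_n}) (x y : 'I_n -> K).

Definition flip B x (i : 'I_n) : K := if i \in B then (x i)^-1 else x i.

(** The part of the summand free of [u], relative to an index set [A] so that an induction can
    remove variables one at a time. *)
Definition weight y A : K :=
  (\prod_(i in A) ((1 - t * y i ^+ 2) / (1 - y i ^+ 2)))
  * \prod_(i in A) \prod_(j in A | (i < j)%N)
      ((1 - t * y i * y j) / (1 - y i * y j)).

Lemma eq_weight y1 y2 A : {in A, y1 =1 y2} -> weight y1 A = weight y2 A.
Proof.
move=> e; congr (_ * _); first by apply: eq_bigr => i iA; rewrite e.
apply: eq_bigr => i iA; apply: eq_bigr => j /andP[jA _].
by rewrite !e.
Qed.

(** Symmetry of [b] is what lets the pairs with [k] as larger index join those with [k] as smaller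
    index in one product. *)
Lemma prod_pairs_setD1 (b : 'I_n -> 'I_n -> K) A k :
  (forall i j, b i j = b j i) -> k \in A ->
  \prod_(i in A) \prod_(j in A | (i < j)%N) b i j
  = (\prod_(i in A :\ k) b k i)
    * \prod_(i in A :\ k) \prod_(j in A :\ k | (i < j)%N) b i j.
Proof.
move=> bC kA; rewrite (big_setD1 k) //=.
have inner i : i \in A :\ k -> \prod_(j in A | (i < j)%N) b i j
    = (if (i < k)%N then b k i else 1)
      * \prod_(j in A :\ k | (i < j)%N) b i j.
  move=> _; rewrite !big_mkcondr (big_setD1 k) //=.
  by rewrite (bC i k).
rewrite (eq_bigr _ inner) big_split /= mulrA; congr (_ * _).
rewrite big_mkcondr /= (big_setD1 k) //= ltnn mul1r -big_split /=.
apply: eq_bigr => i; rewrite !inE => /andP[ik _].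
by move: ik; rewrite -val_eqE /=; case: ltngtP => //= _ _; rewrite ?mulr1 ?mul1r.
Qed.

Lemma weight_setD1 y A k : k \in A ->
  weight y A = (1 - t * y k ^+ 2) / (1 - y k ^+ 2)
    * (\prod_(i in A :\ k) ((1 - t * y k * y i) / (1 - y k * y i)))
    * weight y (A :\ k).
Proof.
move=> kA; rewrite /weight (big_setD1 k) //=.
rewrite (prod_pairs_setD1 (b := fun i j => (1 - t * y i * y j) / (1 - y i * y j))
           _ kA); first by rewrite !mulrA; congr (_ * _); rewrite mulrAC.
by move=> i j; rewrite -!mulrA (mulrC (y i)).
Qed.

Definition quad (a b : K) : {poly K} := (1 - a *: 'X) * (1 - b *: 'X).

Lemma horner_quad a b v : (quad a b).[v] = (1 - a * v) * (1 - b * v).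
Proof. by rewrite /quad !hornerE. Qed.

Lemma quad_sym a b : quad a b = quad b a.
Proof. exact: mulrC. Qed.

Lemma size_quad a b : (size (quad a b) <= 3)%N.
Proof.
have s1 (c : K) : (size (1 - c *: 'X : {poly K})%R <= 2)%N.
  rewrite (leq_trans (size_polyD _ _)) // geq_max size_poly1 size_polyN.
  by rewrite (leq_trans (size_scale_leq _ _)) ?size_polyX.
rewrite (leq_trans (size_polyMleq _ _)) // -subn1 leq_subLR.
exact: leq_trans (leq_add (s1 a) (s1 b)) _.
Qed.

Lemma coef2_quad a b : (quad a b)`_2 = a * b.
Proof.
rewrite /quad coefM !big_ord_recl big_ord0 /= !coefE /=.
by rewrite /bump /=; ring.
Qed.

Section QuadProducts.

Variables (A : {set 'I_n}) (a b : 'I_n -> K).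
Let q := \prod_(i in A) quad (a i) (b i).

Lemma size_prod_quad : (size q <= (2 * #|A|).+1)%N.
Proof.
rewrite /q -big_enum cardE.
by case: (size_coef_prod_le (enum A) (fun i => size_quad (a i) (b i))).
Qed.

Lemma coef_prod_quad : q`_(2 * #|A|) = \prod_(i in A) (a i * b i).
Proof.
rewrite /q -big_enum cardE.
case: (size_coef_prod_le (enum A) (fun i => size_quad (a i) (b i))) => _ ->.
by rewrite big_enum /=; apply: eq_bigr => i _; rewrite coef2_quad.
Qed.

Lemma horner_prod_quad v : q.[v] = \prod_(i in A) ((1 - a i * v) * (1 - b i * v)).
Proof. by rewrite /q horner_prod; apply: eq_bigr => i _; rewrite horner_quad. Qed.

End QuadProducts.

(* As polynomials in u, [numer y A / denom y A] is the product of the factors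
   (1 - t u / y_i) / (1 - u / y_i), written over a denominator which does not
   depend on the signs; likewise [tdenom y A / denom y A] is the product on the
   right-hand side. *)
Definition numer y A : {poly K} := \prod_(i in A) quad (t / y i) (y i).
Definition denom y A : {poly K} := \prod_(i in A) quad (y i) (y i)^-1.
Definition tdenom y A : {poly K} := \prod_(i in A) quad (t * y i) (t / y i).

Lemma tdenom_flip x A B : tdenom (flip B x) A = tdenom x A.
Proof.
apply: eq_bigr => i _; rewrite /flip; case: ifP => // _.
by rewrite invrK quad_sym.
Qed.

Lemma denom_flip x A B : denom (flip B x) A = denom x A.
Proof.
apply: eq_bigr => i _; rewrite /flip; case: ifP => // _.
by rewrite invrK quad_sym.
Qed.

(** This is the residue of one summand at [u = y k], up to a common factor. The factors of the
    weight that involve [k] combine with those of [numer] into [tdenom], which is insensitive to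
    signs, and the weight for the remaining variables is left over. *)
Lemma weight_numer_residue y A k : k \in A -> y k != 0 ->
  {in A, forall i, 1 - y k * y i != 0} ->
  weight y A * (numer y A).[y k] = (tdenom y A).[y k] * weight y (A :\ k).
Proof.
move=> kA yk0 nz; rewrite (weight_setD1 _ kA) !horner_prod_quad.
rewrite !(big_setD1 k kA) /= mulrAC; congr (_ * _).
have -> : \prod_(i in A :\ k) ((1 - t * y i * y k) * (1 - t / y i * y k))
  = \prod_(i in A :\ k) ((1 - t * y k * y i) / (1 - y k * y i))
    * \prod_(i in A :\ k) ((1 - t / y i * y k) * (1 - y i * y k)).
  rewrite -big_split /=; apply: eq_bigr => i; rewrite inE => /andP[_ iA].
  (* The quotient is kept opaque because [y i] is not assumed nonzero for [i] other than [k]; only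
     the factor [1 - y k * y i] has to cancel. *)
  by have nzi := nz i iA; set z := t / y i; field.
by have nzk := nz k kA; field; rewrite yk0 expr2.
Qed.

(** The sign-independent denominator also vanishes at [(y k)^-1], where the original summand has no
    pole; the extra factor [1 - u * y k] of [numer] compensates for this. *)
Lemma numer_root y A k : k \in A -> y k != 0 -> (numer y A).[(y k)^-1] = 0.
Proof.
move=> kA yk0; rewrite horner_prod_quad (big_setD1 k kA) /=.
by rewrite divff // subrr mulr0 mul0r.
Qed.

(** * Vanishing of the defect for [x] in general position *)

Variable x : 'I_n -> K.
Hypothesis x_neq0 : forall i, x i != 0.
Hypothesis x_inj : injective x.
Hypothesis xx_neq1 : forall i j, x i * x j != 1.
Hypothesis t_order : forall m, (0 < m)%N -> t ^+ m != 1.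

Definition signsum A : K := \sum_(B : {set 'I_n} | B \subset A) weight (flip B x) A.

(** The difference of the two sides multiplied by [denom x A], with ['X] in place of [u]. The
    parameter [c] stands for the common value of the sums over the sets [A :\ k], which is only
    computed later. *)
Definition signsum_defect (c : K) A : {poly K} :=
  \sum_(B : {set 'I_n} | B \subset A) weight (flip B x) A *: numer (flip B x) A
  - c *: (t ^+ #|A| *: denom x A + tdenom x A).

Lemma flip_neq0 B i : flip B x i != 0.
Proof. by rewrite /flip; case: ifP; rewrite ?invr_eq0. Qed.

Lemma flip_mul_neq1 B i j : flip B x i * flip B x j != 1.
Proof.
have div_neq1 k l : k != l -> x k / x l != 1.
  by move=> kl; rewrite -subr_eq0 -(mulfV (x_neq0 l)) -mulrBl mulf_neq0
    ?invr_eq0 // subr_eq0 (inj_eq x_inj).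
have [<-|ij] := eqVneq i j.
  rewrite /flip; case: ifP => // _; rewrite -invfM invr_eq1; exact: xx_neq1.
rewrite /flip; case: ifP => _; case: ifP => _ //.
- by rewrite -invfM invr_eq1; exact: xx_neq1.
- by rewrite mulrC div_neq1 // eq_sym.
- exact: div_neq1.
Qed.

Lemma denom_root A k : k \in A ->
  (denom x A).[x k] = 0 /\ (denom x A).[(x k)^-1] = 0.
Proof.
move=> kA; split; rewrite horner_prod_quad (big_setD1 k kA) /=.
  by rewrite mulVf // subrr mulr0 mul0r.
by rewrite mulfV // subrr !mul0r.
Qed.

Lemma denom_root_inv A v : (denom x A).[v] = 0 ->
  exists2 i, i \in A & v = x i \/ v = (x i)^-1.
Proof.
move/eqP; rewrite horner_prod_quad prodf_seq_eq0 => /hasP[i _ /andP[iA]].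
rewrite mulf_eq0 !subr_eq0 => /orP[]/eqP e; exists i => //.
  by right; rewrite -[v](mulKf (x_neq0 i)) -e mulr1.
by left; rewrite -[v](mulVKf (x_neq0 i)) -e mulr1.
Qed.

(** For each [B] avoiding [k], exactly one of [B] and [k |: B] survives at a given point:
    [numer_root] kills the other, and [weight_numer_residue] evaluates the survivor. *)
Lemma sum_numer_at A k : k \in A ->
  \sum_(B : {set 'I_n} | B \subset A)
     weight (flip B x) A * (numer (flip B x) A).[x k]
    = (tdenom x A).[x k] * signsum (A :\ k) /\
  \sum_(B : {set 'I_n} | B \subset A)
     weight (flip B x) A * (numer (flip B x) A).[(x k)^-1]
    = (tdenom x A).[(x k)^-1] * signsum (A :\ k).
Proof.
move=> kA.
have nz B i : i \in A -> 1 - flip B x k * flip B x i != 0.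
  by move=> _; rewrite subr_eq0 eq_sym flip_mul_neq1.
have inB B : flip (k |: B) x k = (x k)^-1 by rewrite /flip setU11.
have ninB B : B \subset A :\ k -> flip B x k = x k.
  by rewrite subsetD1 => /andP[_ /negPf kB]; rewrite /flip kB.
have Wk B : weight (flip (k |: B) x) (A :\ k) = weight (flip B x) (A :\ k).
  apply: eq_weight => i; rewrite !inE => /andP[/negPf ik _].
  by rewrite /flip !inE ik.
split; rewrite (sum_subset_setD1 _ kA) /signsum mulr_sumr; apply: eq_bigr => B BA.
  rewrite -{1}(ninB _ BA) weight_numer_residue ?flip_neq0 //; last exact: nz.
  rewrite ninB // tdenom_flip -[X in _ + _ * _.[X]]invrK -(inB B).
  by rewrite numer_root ?flip_neq0 // mulr0 addr0.
rewrite -{1}(ninB _ BA) numer_root ?flip_neq0 // mulr0 add0r -(inB B).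
by rewrite weight_numer_residue ?flip_neq0 ?tdenom_flip ?Wk //; exact: nz.
Qed.

Lemma defect_root A k c : k \in A -> signsum (A :\ k) = c ->
  (signsum_defect c A).[x k] = 0 /\ (signsum_defect c A).[(x k)^-1] = 0.
Proof.
move=> kA Sc; have [D1 D2] := denom_root kA; have [N1 N2] := sum_numer_at kA.
split; rewrite /signsum_defect !hornerE horner_sum ?D1 ?D2 mulr0 add0r.
  by under eq_bigr do rewrite hornerZ; rewrite N1 Sc mulrC subrr.
by under eq_bigr do rewrite hornerZ; rewrite N2 Sc mulrC subrr.
Qed.

Lemma horner0_prod_quad A (a b : 'I_n -> K) :
  (\prod_(i in A) quad (a i) (b i)).[0] = 1.
Proof.
by rewrite horner_prod_quad big1 // => i _; rewrite !mulr0 subr0 mulr1.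
Qed.

Lemma defect_at0 A c :
  (signsum_defect c A).[0] = signsum A - c * (t ^+ #|A| + 1).
Proof.
rewrite /signsum_defect !hornerE horner_sum !horner0_prod_quad mulr1.
by under eq_bigr do rewrite hornerZ horner0_prod_quad mulr1.
Qed.

Lemma coef_denom A : (denom x A)`_(2 * #|A|) = 1.
Proof. by rewrite coef_prod_quad big1 // => i _; rewrite mulfV. Qed.

(** The top coefficients of [numer], [denom] and [tdenom] are [t ^+ #|A|], [1] and
    [t ^+ (2 * #|A|)], whereas all three take the value [1] at [0]. *)
Lemma defect_top_coef A c :
  (signsum_defect c A)`_(2 * #|A|) = t ^+ #|A| * (signsum_defect c A).[0].
Proof.
rewrite defect_at0 /signsum_defect coefB coef_sum coefZ coefD coefZ.
rewrite coef_denom coef_prod_quad.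
have -> : \prod_(i in A) (t * x i * (t / x i)) = t ^+ #|A| * t ^+ #|A|.
  rewrite -exprMn -prodr_const; apply: eq_bigr => i _.
  by field; exact: x_neq0.
have coefN B : (numer (flip B x) A)`_(2 * #|A|) = t ^+ #|A|.
  rewrite coef_prod_quad -prodr_const; apply: eq_bigr => i _.
  by rewrite divfK ?flip_neq0.
under eq_bigr do rewrite coefZ coefN.
by rewrite -mulr_suml -/(signsum A); ring.
Qed.

Lemma size_defect A c : (size (signsum_defect c A) <= (2 * #|A|).+1)%N.
Proof.
rewrite /signsum_defect (leq_trans (size_polyD _ _)) // geq_max size_polyN.
apply/andP; split.
  apply: (leq_trans (size_sum _ _ _)); apply/bigmax_leqP => B _.
  by rewrite (leq_trans (size_scale_leq _ _)) ?size_prod_quad.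
rewrite (leq_trans (size_scale_leq _ _)) // (leq_trans (size_polyD _ _)) //.
rewrite geq_max size_prod_quad andbT.
by rewrite (leq_trans (size_scale_leq _ _)) ?size_prod_quad.
Qed.

(* Once its values at the [x k] and [1 / x k] vanish, the defect is a constant
   multiple of the denominator; comparing the values at [0] and at infinity then
   multiplies that constant by [t ^+ #|A|], so it is zero. *)
Lemma defect_eq0 A c : A != set0 ->
  {in A, forall k, signsum (A :\ k) = c} -> signsum_defect c A = 0.
Proof.
move=> A0 Sc; set G := signsum_defect c A.
pose H := G - G.[0] *: denom x A.
(* These are [2 * #|A| + 1] distinct points, one more than the degree bound on [H]. The point [0] is
   a root because [denom x A] takes the value [1] there. *)
pose rs := 0 :: [seq x i | i <- enum A] ++ [seq (x i)^-1 | i <- enum A].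
have rs_uniq : uniq rs.
  rewrite /rs /= mem_cat negb_or cat_uniq !map_inj_uniq ?enum_uniq //=; last first.
    by move=> i j /invr_inj /x_inj.
  rewrite andbT -andbA; apply/and3P; split.
  - by apply/mapP => -[i _ /eqP]; rewrite eq_sym (negPf (x_neq0 i)).
  - by apply/mapP => -[i _ /eqP]; rewrite eq_sym invr_eq0 (negPf (x_neq0 i)).
  apply/hasPn => _ /mapP[i _ ->]; apply/mapP => -[j _ e].
  by have := xx_neq1 i j; rewrite -e mulfV ?eqxx.
have rs_root : all (root H) rs.
  apply/allP => v; rewrite /rs inE mem_cat rootE /H hornerD hornerN hornerZ.
  case/or3P=> [/eqP->|/mapP[k]|/mapP[k]].
  - by rewrite horner0_prod_quad mulr1 subrr.
  - rewrite mem_enum => kA ->; have [-> _] := defect_root kA (Sc k kA).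
    by have [-> _] := denom_root kA; rewrite mulr0 subr0.
  - rewrite mem_enum => kA ->; have [_ ->] := defect_root kA (Sc k kA).
    by have [_ ->] := denom_root kA; rewrite mulr0 subr0.
have sizeH : (size H <= (2 * #|A|).+1)%N.
  rewrite (leq_trans (size_polyD _ _)) // geq_max size_polyN size_defect.
  by rewrite (leq_trans (size_scale_leq _ _)) ?size_prod_quad.
have H0 : H = 0.
  apply/eqP/negPn/negP => nzH.
  have := leq_trans (max_poly_roots nzH rs_root rs_uniq) sizeH.
  by rewrite /rs /= size_cat !size_map -cardE mul2n -addnn ltnn.
have eG : G = G.[0] *: denom x A by apply/eqP; rewrite -subr_eq0 -/H H0.
have G0 : G.[0] = 0.
  have := defect_top_coef A c; rewrite -/G {1}eG coefZ coef_denom mulr1 => e.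
  have : (1 - t ^+ #|A|) * G.[0] = 0 by rewrite mulrBl mul1r -e subrr.
  move/eqP; rewrite mulf_eq0 subr_eq0 eq_sym (negPf (t_order _)) ?card_gt0 //.
  by move/eqP.
by rewrite eG G0 scale0r.
Qed.

(** This is the identity at [u = 0], by strong induction on [#|A|]: the induction hypothesis
    supplies the constant [c] that makes the defect vanish, and evaluating the defect at [0] yields
    the new factor [t ^+ #|A| + 1]. *)
Lemma signsumE A : signsum A = \prod_(1 <= i < #|A|.+1) (t ^+ i + 1).
Proof.
elim: {A}_.+1 {-2}A (ltnSn #|A|) => // m IH A; rewrite ltnS => Am.
have [->|A0] := eqVneq A set0.
  rewrite cards0 big_geq // /signsum (bigD1 set0) //= big1 => [|B].
    by rewrite addr0 /weight !big_set0 mulr1.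
  by rewrite subset0 => /andP[/eqP->]; rewrite eqxx.
have A_gt0 : (0 < #|A|)%N by rewrite card_gt0.
have := defect_at0 A (\prod_(1 <= i < #|A|) (t ^+ i + 1)).
rewrite defect_eq0 // => [|k kA].
  rewrite horner0 => /esym/eqP; rewrite subr_eq0 => /eqP ->.
  by rewrite big_nat_recr.
have cA := cardsD1 k A; rewrite kA add1n in cA.
by rewrite IH -cA.
Qed.

(** The vanishing defect is evaluated at [v] and divided by the value of the denominator. *)
Lemma signsum_with_u A v : A != set0 -> (denom x A).[v] != 0 ->
  \sum_(B : {set 'I_n} | B \subset A)
     weight (flip B x) A
     * \prod_(i in A) ((1 - t * v / flip B x i) / (1 - v / flip B x i))
  = (\prod_(1 <= i < #|A|) (t ^+ i + 1))
    * (t ^+ #|A| + \prod_(i in A) ((1 - t * v * x i) / (1 - v * x i)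
                       * ((1 - t * v / x i) / (1 - v / x i)))).
Proof.
move=> A0 Dv; set c := \prod_(1 <= i < _) _.
have : (signsum_defect c A).[v] = 0.
  rewrite defect_eq0 ?horner0 // => k kA; rewrite signsumE /c.
  by rewrite (cardsD1 k A) kA.
rewrite /signsum_defect !hornerE horner_sum => /eqP; rewrite subr_eq0 => /eqP E.
have -> : \prod_(i in A) ((1 - t * v * x i) / (1 - v * x i)
             * ((1 - t * v / x i) / (1 - v / x i)))
          = (tdenom x A).[v] / (denom x A).[v].
  rewrite !horner_prod_quad -prodf_div; apply: eq_bigr => i _.
  by rewrite mulf_div; congr (_ * _ / (_ * _)); ring.
apply: (mulIf Dv); rewrite -mulrA mulrDl divfK // -E mulr_suml.
apply: eq_bigr => B _; rewrite hornerZ -mulrA; congr (_ * _).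
rewrite -(denom_flip x A B) !horner_prod_quad -big_split /=.
have := Dv; rewrite -(denom_flip x A B) horner_prod_quad => /prodf_neq0 nz.
apply: eq_bigr => i iA; have := nz i iA; rewrite mulf_eq0 negb_or => /andP[_].
by set z := (flip B x i)^-1 => zv; field; rewrite mulrC.
Qed.

End SignSum.

(** * The operators [T_i] as field morphisms, and expansion of their product *)

Section Expansion.

Variables (F : fieldType) (n : nat).
Local Notation K := (ratfun F n).
Local Notation tofrac := (@FracField.tofrac {mpoly F[2 + n]}).

(** Brings an arbitrary element to the form on which [invxE] computes. *)
Lemma ratfunP (f : K) :
  exists2 pq : {mpoly F[2 + n]} * {mpoly F[2 + n]},
    pq.2 != 0 & f = tofrac pq.1 / tofrac pq.2.
Proof.
exists (\n_(repr f), \d_(repr f)) => /=; first exact: denom_ratioP.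
rewrite -[LHS]reprK -[X in \pi X]Ratio_numden.
set a := \n_(_); set b := \d_(_).
have nz_b : b != 0 by apply: denom_ratioP.
apply/esym; rewrite /GRing.inv /GRing.mul /= !piE; apply/eqmodP => /=.
rewrite FracField.equivfE /FracField.mulf /FracField.invf.
by rewrite !numden_Ratio ?mulf_neq0 ?oner_eq0 // mulr1 mul1r mulrC.
Qed.

Lemma invx_is_zmod_morphism (i : 'I_n) : zmod_morphism (@invx F n i).
Proof.
move=> f g; have [[a b] /= b0 ->] := ratfunP f; have [[c d] /= d0 ->] := ratfunP g.
have bd0 : b * d != 0 by rewrite mulf_neq0.
have -> : tofrac a / tofrac b - tofrac c / tofrac d
        = tofrac (a * d - c * b) / tofrac (b * d).
  rewrite -mulNr addf_div ?tofrac_eq0 // tofracB !tofracM.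
  by rewrite mulNr.
rewrite !invxE // -[- (_ / _)]mulNr addf_div ?invx_poly_eq0 // /invx_poly.
by rewrite rmorphB !rmorphM mulNr.
Qed.

Lemma invx_is_monoid_morphism (i : 'I_n) : monoid_morphism (@invx F n i).
Proof.
split=> [|f g].
  rewrite -[X in invx i X](divff (oner_neq0 K)) -tofrac1 invxE ?oner_neq0 //.
  by rewrite /invx_poly rmorph1 divr1.
have [[a b] /= b0 ->] := ratfunP f; have [[c d] /= d0 ->] := ratfunP g.
rewrite mulf_div -!tofracM !invxE ?mulf_neq0 // mulf_div /invx_poly.
by rewrite !rmorphM.
Qed.

HB.instance Definition _ i :=
  GRing.isZmodMorphism.Build K K (@invx F n i) (invx_is_zmod_morphism i).
HB.instance Definition _ i :=
  GRing.isMonoidMorphism.Build K K (@invx F n i) (invx_is_monoid_morphism i).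

Lemma invx_ratvar (i : 'I_n) k :
  invx i (ratvar F k) = if k == rshift 2 i then (ratvar F k)^-1 else ratvar F k.
Proof.
rewrite -[X in invx i X]divr1 {1}/ratvar -tofrac1 invxE ?oner_neq0 //.
by rewrite /invx_poly rmorph1 divr1 mmapX mmap1U.
Qed.

Lemma invx_tvar i : invx i (tvar F n) = tvar F n.
Proof. by rewrite invx_ratvar eq_lrshift. Qed.

Lemma invx_uvar i : invx i (uvar F n) = uvar F n.
Proof. by rewrite invx_ratvar eq_lrshift. Qed.

Lemma invx_flip (B : {set 'I_n}) i j : i \notin B ->
  invx i (flip B (@xvar F n) j) = flip (i |: B) (@xvar F n) j.
Proof.
move=> iB; rewrite /flip !inE.
have [->|ji] := eqVneq j i.
  by rewrite (negPf iB) /= invx_ratvar eqxx.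
by case: ifP => _; rewrite ?fmorphV /= invx_ratvar eq_rshift (negPf ji).
Qed.

(** The expression is abstracted as a function [E] of the variables that commutes with every [T_i],
    so each operator acts on the arguments alone and turns [flip B] into [flip (i |: B)]. *)
Lemma prod_one_plus_T_expand (E : ('I_n -> K) -> K) :
  (forall y1 y2, y1 =1 y2 -> E y1 = E y2) ->
  (forall i y, invx i (E y) = E (fun j => invx i (y j))) ->
  prod_one_plus_T (E (@xvar F n))
  = \sum_(B : {set 'I_n}) E (flip B (@xvar F n)).
Proof.
move=> eqE invE.
(* Lists without repetition ensure that [i] lies outside every [B] coming from the tail, so that no
   variable is inverted twice. *)
suff expand (r : seq 'I_n) : uniq r ->
    (\big[comp/id]_(i <- r) @one_plus_T F n i) (E (@xvar F n))
    = \sum_(B : {set 'I_n} | B \subset [set j in r]) E (flip B (@xvar F n)).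
  rewrite /prod_one_plus_T expand ?index_enum_uniq //; apply: eq_bigl => B.
  by apply/subsetP => j _; rewrite inE mem_index_enum.
elim: r => [_|i r IH /= /andP[ir ur]].
  rewrite big_nil (bigD1 set0) ?sub0set //= big1 ?addr0 => [|B].
    by apply: eqE => j; rewrite /flip inE.
  rewrite -subset0 => /andP[Br]; case/negP; apply/subsetP => j /(subsetP Br).
  by rewrite !inE.
rewrite big_cons /= IH // [RHS](@sum_subset_setD1 _ _ _ i); last by rewrite !inE eqxx.
have -> : [set j in i :: r] :\ i = [set j in r].
  by apply/setP => j; rewrite !inE; case: eqVneq => // ->; rewrite (negPf ir).
rewrite /one_plus_T big_split rmorph_sum /=; congr (_ + _).
apply: eq_bigr => B Br; rewrite invE; apply: eqE => j; apply: invx_flip.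
by apply: contra ir => /(subsetP Br); rewrite inE.
Qed.

(** * General position of the indeterminates, by comparing monomials *)

Lemma mpolyX_eq1 (m : 'X_{1..2 + n}) : (tofrac 'X_[m] == 1) = (m == 0%MM).
Proof.
rewrite -tofrac1 tofrac_eq -mpolyX0; apply/eqP/eqP => [/mpolyP/(_ m)|-> //].
rewrite !mcoeffX eqxx; by case: eqP => // _ /eqP; rewrite oner_eq0.
Qed.

Lemma ratvar_mul_neq1 (k l : 'I_(2 + n)) : ratvar F k * ratvar F l != 1.
Proof.
rewrite /ratvar -tofracM -mpolyXD mpolyX_eq1; apply/eqP => /mnmP/(_ k).
by rewrite mnmDE mnm1E eqxx mnm0E.
Qed.

Lemma ratvar_inj : injective (@ratvar F n).
Proof.
move=> k l /eqP; rewrite tofrac_eq => /eqP/mpolyP/(_ U_(k)%MM).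
rewrite !mcoeffX eqxx.
case: eqP => [/mnmP/(_ k)|_ /eqP]; last by rewrite oner_eq0.
by rewrite !mnm1E eqxx; case: (eqVneq l k).
Qed.

Lemma tvar_order m : (0 < m)%N -> tvar F n ^+ m != 1.
Proof.
move=> m_gt0; rewrite /tvar /ratvar -tofracXn mpolyXn mpolyX_eq1.
apply/eqP => /mnmP/(_ (lshift n ord0)).
by rewrite mulmnE mnm1E eqxx mnm0E mul1n => e; rewrite e in m_gt0.
Qed.

End Expansion.

Theorem theorem5 (F : fieldType) (n : nat) (n_ge1 : (1 <= n)%N) :
  let t : ratfun F n := tvar F n in
  let u : ratfun F n := uvar F n in
  let x : 'I_n -> ratfun F n := @xvar F n in
  prod_one_plus_T
    ((\prod_(i < n) ((1 - t * x i ^+ 2) / (1 - x i ^+ 2)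
                     * ((1 - t * u / x i) / (1 - u / x i))))
     * \prod_(i < n) \prod_(j < n | (i < j)%N)
         ((1 - t * x i * x j) / (1 - x i * x j)))
  = (\prod_(1 <= i < n) (t ^+ i + 1))
    * (t ^+ n
       + \prod_(i < n) ((1 - t * u * x i) / (1 - u * x i)
                        * ((1 - t * u / x i) / (1 - u / x i)))).
Proof.
move=> t u x.
(* Only the [x i] become arguments; [t] and [u] stay fixed, being invariant under every [T_i]. *)
pose E (y : 'I_n -> ratfun F n) :=
  (\prod_(i < n) ((1 - t * y i ^+ 2) / (1 - y i ^+ 2)
                     * ((1 - t * u / y i) / (1 - u / y i))))
     * \prod_(i < n) \prod_(j < n | (i < j)%N)
         ((1 - t * y i * y j) / (1 - y i * y j)).
have invxt i : invx i t = t := invx_tvar F i.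
have invxu i : invx i u = u := invx_uvar F i.
rewrite (@prod_one_plus_T_expand F n E); first last.
- move=> i y; rewrite /E rmorphM !rmorph_prod /=; congr (_ * _).
    apply: eq_bigr => j _.
    rewrite rmorphM !fmorph_div !rmorphB !rmorph1 !fmorph_div /=.
    by rewrite !rmorphM /= invxt invxu -!expr2.
  apply: eq_bigr => j _; rewrite rmorph_prod; apply: eq_bigr => k _.
  by rewrite fmorph_div !rmorphB !rmorphM !rmorph1 /= invxt.
- move=> y1 y2 e; rewrite /E; congr (_ * _); apply: eq_bigr => j _.
    by rewrite e.
  by apply: eq_bigr => k _; rewrite !e.
have x_neq0 i : x i != 0 by apply: ratvar_neq0.
have x_inj : injective x by move=> i j /ratvar_inj /rshift_inj.
(* The roots of the denominator are the [x i] and their inverses, and the indeterminate [u] is none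
   of these. *)
have nzD : (denom x setT).[u] != 0.
  apply/eqP => /(denom_root_inv x_neq0)[i _ [/ratvar_inj/eqP|]].
    by rewrite eq_lrshift.
  by move=> e; have := ratvar_mul_neq1 F (lshift n ord_max) (rshift 2 i);
    rewrite -/(uvar F n) -/u e mulVf ?eqxx.
have T0 : [set: 'I_n] != set0.
  by rewrite -card_gt0 cardsT card_ord.
have xx_neq1 i j : x i * x j != 1 by exact: ratvar_mul_neq1.
have := signsum_with_u x_neq0 x_inj xx_neq1 (@tvar_order F n) T0 nzD.
rewrite cardsT card_ord => main.
rewrite [X in _ = _ * (_ + X)](eq_bigl (fun i => i \in [set: 'I_n])); last first.
  by move=> i; rewrite inE.
rewrite -[RHS]main.
apply: eq_big => [B|B _]; first by rewrite subsetT.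
rewrite /E /weight big_split /= mulrAC; congr (_ * _ * _).
- by apply: eq_bigl => i; rewrite inE.
- apply: eq_big => [i|i _]; first by rewrite inE.
  by apply: eq_bigl => j; rewrite inE.
- by apply: eq_bigl => i; rewrite inE.
Qed.
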